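(* Let $n\ge3$, let $P$ be a positive-area local optimum with $\Delta=\delta(P)$, and let $\theta=(\lambda,\ell,r,d,u)$ be a point of the relative interior of the KKT polytope $\mathcal K(P)$, with outward reactions $b_i=(r_i-\ell_i,u_i-d_i)$. Let $C_1,\dots,C_c$ be the positive components and $\alpha_a=\sum_{t\subset C_a}\lambda_t>0$. Then for every $a$, viewing $p_i,b_i$ as column vectors, $$\sum_{i\in C_a}b_i=0,\qquad \sum_{i\in C_a}p_ib_i^T=\alpha_a\,\Delta\, I_2 .$$ Consequently each $C_a$ carries a positive reaction on each of the four sides of the square (that is, there are $i_1,i_2,i_3,i_4\in C_a$ with $\ell_{i_1}>0$, $r_{i_2}>0$, $d_{i_3}>0$, $u_{i_4}>0$), and $c\le2$.
   Context: A configuration is $P=(p_1,\dots,p_n)$ with $p_i=(x_i,y_i)\in[0,1]^2$. For a triple $t=(i,j,k)$, $i<j<k$, put $D_t(P)=\det(p_j-p_i,p_k-p_i)$, $A_t(P)=\tfrac12|D_t(P)|$, and $\delta(P)=\min_tA_t(P)$. A positive-area local optimum is a local maximizer $P$ of $\delta$ on $([0,1]^2)^n$ with $\Delta:=\delta(P)>0$. Put $s_t=\operatorname{sgn}D_t(P)$; near $P$, $A_t=\tfrac12s_tD_t$, which is used for derivatives. A normalized KKT multiplier at $P$ is a tuple $\theta=(\lambda,\ell,r,d,u)$ of nonnegative reals $\lambda_t$ (all triples $t$), $\ell_i,r_i,d_i,u_i$ ($i\in[n]$) with: $\lambda_t=0$ unless $A_t(P)=\Delta$; $\ell_i=0$ unless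 $x_i=0$, $r_i=0$ unless $x_i=1$, $d_i=0$ unless $y_i=0$, $u_i=0$ unless $y_i=1$; $\sum_t\lambda_t=1$; and $\sum_t\lambda_t\nabla_{p_i}A_t(P)+(\ell_i-r_i,d_i-u_i)=0$ for all $i$. The set of these is the (compact) KKT polytope $\mathcal K(P)$. For a relative-interior multiplier, consider the hypergraph on $[n]$ whose hyperedges are the triples $t$ with $\lambda_t>0$. A positive component is (the vertex set of) a connected component of this hypergraph containing at least one hyperedge; vertices in no hyperedge are omitted. *)

(* Defs.v *)
From HB Require Import structures.
From mathcomp Require Import all_boot all_order all_algebra.
From mathcomp Require Import all_classical all_reals all_analysis.

Set Implicit Arguments.
Unset Strict Implicit.
Unset Printing Implicit Defensive.
Import Order.TTheory GRing.Theory Num.Theory.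
Import numFieldNormedType.Exports.
Local Open Scope classical_set_scope.
Local Open Scope ring_scope.

Definition affine_hull (R : realType) (V : normedModType R) (S : set V) : set V :=
  [set y | exists m (c : 'I_m -> R) (x : 'I_m -> V),
    [/\ forall k, S (x k), \sum_k c k = 1 & y = \sum_k c k *: x k]].

Definition relint (R : realType) (V : normedModType R) (S : set V) : set V :=
  [set x | S x /\ \forall y \near x, affine_hull S y -> S y].

Definition increasing n (t : 'I_n * 'I_n * 'I_n) : bool :=
  ((t.1.1 < t.1.2) && (t.1.2 < t.2))%N.

Definition triple n : finType := {t : 'I_n * 'I_n * 'I_n | increasing t}.

Definition ti n (t : triple n) : 'I_n := (val t).1.1.
Definition tj n (t : triple n) : 'I_n := (val t).1.2.
Definition tk n (t : triple n) : 'I_n := (val t).2.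

Definition tset n (t : triple n) : {set 'I_n} := [set ti t; tj t; tk t]%SET.

(* A configuration of n points in the plane is a 2 x n matrix whose i-th
   column is p_i = (x_i, y_i)^T; its row ix lists the x_i, its row iy the y_i. *)
Definition ix : 'I_2 := ord0.
Definition iy : 'I_2 := ord_max.

Definition orient (R : realType) n (P : 'M[R]_(2, n)) (t : triple n) : R :=
  \det (row_mx (col (tj t) P - col (ti t) P) (col (tk t) P - col (ti t) P)
        : 'M[R]_2).

Definition area (R : realType) n (P : 'M[R]_(2, n)) (t : triple n) : R :=
  2^-1 * `|orient P t|.

(* The infimum of a finite family; for n >= 3 the family is nonempty and this
   is its minimum, see delta_is_min. *)
Definition delta (R : realType) n (P : 'M[R]_(2, n)) : R :=
  inf (range (area P)).

Lemma delta_is_min (R : realType) n (P : 'M[R]_(2, n)) : (2 < n)%N ->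
  (exists t, area P t = delta P) /\ (forall t, delta P <= area P t).
Proof.
move=> n2.
pose o k (h : (k < 3)%N) : 'I_n := Ordinal (leq_trans h n2).
have h0 : increasing (@o 0%N isT, @o 1%N isT, @o 2%N isT) by [].
have [t _ tmin] := @Order.TotalTheory.arg_minP _ _ _
  (Sub _ h0 : triple n) xpredT (area P) isT.
have lbt : lbound (range (area P)) (area P t) by move=> _ [s _ <-]; exact: tmin.
have eqt : area P t = delta P.
  apply/eqP; rewrite eq_le; apply/andP; split.
    by apply: lb_le_inf => //; exists (area P t), t.
  by apply: ge_inf; [exists (area P t) | exists t].
by split; [exists t | move=> s; rewrite -eqt tmin].
Qed.

Definition in_square (R : realType) n (P : 'M[R]_(2, n)) : Prop :=
  forall a i, 0 <= P a i <= 1.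

Definition pos_local_opt (R : realType) n (P : 'M[R]_(2, n)) : Prop :=
  [/\ in_square P,
      \forall Q \near P, in_square Q -> delta Q <= delta P
    & 0 < delta P].

(* The gradient of A_t with respect to the point p_i. All A_t are nonzero at a
   positive-area configuration, so the absolute value is smooth there. *)
Definition grad_area (R : realType) n (P : 'M[R]_(2, n)) (t : triple n)
    (i : 'I_n) : 'cV[R]_2 :=
  \col_(a < 2) 'D_(delta_mx a i) (fun Q : 'M[R]_(2, n) => area Q t) P.

Definition col2 (R : realType) (x y : R) : 'cV[R]_2 :=
  \col_(a < 2) (if a == ix then x else y).

(* Families indexed by the triples are row vectors over an enumeration of
   triple n, so that multipliers live in a normed module. *)
Definition wt (R : realType) n (lam : 'rV[R]_#|triple n|) (t : triple n) : R :=
  lam 0 (enum_rank t).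

Definition KKT_multiplier (R : realType) n (P : 'M[R]_(2, n))
    (lam : 'rV[R]_#|triple n|) (l r d u : 'rV[R]_n) : Prop :=
  [/\ (forall t, 0 <= wt lam t)
      /\ (forall i, [/\ 0 <= l 0 i, 0 <= r 0 i, 0 <= d 0 i & 0 <= u 0 i]),
      forall t, area P t <> delta P -> wt lam t = 0,
      forall i, [/\ P ix i <> 0 -> l 0 i = 0, P ix i <> 1 -> r 0 i = 0,
                    P iy i <> 0 -> d 0 i = 0 & P iy i <> 1 -> u 0 i = 0],
      \sum_t wt lam t = 1
    & forall i, \sum_t wt lam t *: grad_area P t i
                + col2 (l 0 i - r 0 i) (d 0 i - u 0 i) = 0].

Definition KKT (R : realType) n (P : 'M[R]_(2, n)) :
    set ('rV[R]_#|triple n| * 'rV[R]_n * 'rV[R]_n * 'rV[R]_n * 'rV[R]_n)%type :=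
  [set theta | let: (lam, l, r, d, u) := theta in
    KKT_multiplier P lam l r d u].

Definition reaction (R : realType) n (l r d u : 'rV[R]_n) (i : 'I_n) : 'cV[R]_2 :=
  col2 (r 0 i - l 0 i) (u 0 i - d 0 i).

Definition hyperadj (R : realType) n (lam : 'rV[R]_#|triple n|) : rel 'I_n :=
  [rel i j | [exists t, [&& 0 < wt lam t, i \in tset t & j \in tset t]]].

Definition components (R : realType) n (lam : 'rV[R]_#|triple n|) :
    {set {set 'I_n}} :=
  [set [set j | connect (hyperadj lam) i j] | i : 'I_n]%SET.

Definition pos_components (R : realType) n (lam : 'rV[R]_#|triple n|) :
    {set {set 'I_n}} :=
  [set C in components lam |
    [exists t, (0 < wt lam t) && (tset t \subset C)]]%SET.

Definition comp_weight (R : realType) n (lam : 'rV[R]_#|triple n|)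
    (C : {set 'I_n}) : R :=
  \sum_(t | tset t \subset C) wt lam t.

(* Main.v *)
(* Stationarity says b_i = sum_t lambda_t grad_{p_i} A_t. Each triple with
   lambda_t > 0 lies inside or outside a component, so summing over a component
   only sees its own triples: translation invariance of A_t gives the force
   balance, and equivariance under linear maps, A_t(MP) = det(M) A_t(P) for M
   near the identity, gives the moment identity. Its diagonal entries are the
   total reactions on the right and top sides, and force balance transfers them
   to the left and bottom sides. Three components would put three collinear
   points on the left side, contradicting delta(P) > 0. *)

Require Import Defs.
From mathcomp Require Import all_boot all_order all_algebra.
From mathcomp Require Import all_classical all_reals all_analysis.
From mathcomp Require Import ring.
Import Order.TTheory GRing.Theory Num.Theory.
Import numFieldNormedType.Exports.
Local Open Scope classical_set_scope.
Local Open Scope ring_scope.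
Set Implicit Arguments.
Unset Strict Implicit.
Unset Printing Implicit Defensive.

(** * Orientation determinants and gradients of the areas *)

Lemma det_mx22 (R : comPzRingType) (A : 'M[R]_2) :
  \det A = A ix ix * A iy iy - A ix iy * A iy ix.
Proof.
rewrite (expand_det_row _ ix) big_ord_recl big_ord1 /cofactor !det_mx11 !mxE /=.
have -> : lift ix 0 = iy by exact: val_inj.
have -> : lift iy 0 = ix by exact: val_inj.
by rewrite -/ix; ring.
Qed.

Lemma orientE (R : realType) n (P : 'M[R]_(2, n)) (t : triple n) :
  orient P t =
    (P ix (tj t) - P ix (ti t)) * (P iy (tk t) - P iy (ti t))
    - (P ix (tk t) - P ix (ti t)) * (P iy (tj t) - P iy (ti t)).
Proof.
have El (A B : 'cV[R]_2) i : (row_mx A B : 'M[R]_2) i ix = A i 0.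
  by rewrite -(row_mxEl A B); congr (row_mx A B i _); exact: val_inj.
have Er (A B : 'cV[R]_2) i : (row_mx A B : 'M[R]_2) i iy = B i 0.
  by rewrite -(row_mxEr A B); congr (row_mx A B i _); exact: val_inj.
by rewrite /orient det_mx22 !El !Er !mxE; ring.
Qed.

(** The edge vector from [i] to [j], turned clockwise by a quarter turn. *)
Definition edge_normal (R : realType) n (P : 'M[R]_(2, n)) (i j : 'I_n)
    (a : 'I_2) : R :=
  if a == ix then P iy j - P iy i else P ix i - P ix j.

(** The derivative of a signed area at a vertex is normal to the opposite edge. The indicators
    extend this closed form to all [m]. *)
Definition grad_orient (R : realType) n (P : 'M[R]_(2, n)) (t : triple n)
    (m : 'I_n) (a : 'I_2) : R :=
  - (m == ti t)%:R * edge_normal P (tj t) (tk t) a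
  + (m == tj t)%:R * edge_normal P (ti t) (tk t) a
  - (m == tk t)%:R * edge_normal P (ti t) (tj t) a.

Lemma I2P (a : 'I_2) : a = ix \/ a = iy.
Proof. by case: a => [[|[|//]] h]; [left|right]; apply: val_inj. Qed.

(* Moving a single point makes the determinant exactly affine in the step. *)
Lemma orient_shift (R : realType) n (P : 'M[R]_(2, n)) (t : triple n)
    (m : 'I_n) (a : 'I_2) (h : R) :
  orient (h *: delta_mx a m + P) t = orient P t + h * grad_orient P t m a.
Proof.
rewrite !orientE /grad_orient /edge_normal !mxE !(eq_sym _ m).
by case: (I2P a) => ->; rewrite /=; ring.
Qed.

(** A nonzero determinant keeps its sign under small moves, so the absolute value is locally
    multiplication by that sign. *)
Lemma grad_areaE (R : realType) n (P : 'M[R]_(2, n)) (t : triple n)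
    (m : 'I_n) (a : 'I_2) : orient P t != 0 ->
  grad_area P t m a 0 = 2^-1 * Num.sg (orient P t) * grad_orient P t m a.
Proof.
move=> D0; rewrite mxE /derive; apply: cvg_lim; first exact: Rhausdorff.
(* Along a coordinate direction the determinant is affine, so the difference quotient already equals
   its limit for small nonzero steps. *)
apply: cvg_near_cst.
set D := orient P t; set L := grad_orient P t m a.
have sgD_cvg : (Num.sg D * (D + h * L)) @[h --> 0^'] --> `|D|.
  have -> : `|D| = Num.sg D * (D + 0 * L) by rewrite mul0r addr0 -normrEsg.
  apply: cvgMl_tmp; apply: cvgD; first exact: cvg_cst.
  by apply: cvgMr_tmp; exact: nbhs_dnbhs.
have sgD_gt0 : \forall h \near 0^', 0 < Num.sg D * (D + h * L).
  by apply: cvgr_gt sgD_cvg _ _; rewrite normr_gt0.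
apply: filterS2 (nbhs_dnbhs_neq 0) sgD_gt0 => h h0 h_pos.
rewrite /= /area orient_shift -/D -/L.
have -> : `|D + h * L| = Num.sg D * (D + h * L).
  by rewrite -[RHS]gtr0_norm // normrM normr_sg D0 mul1r.
rewrite [`|D|]normrEsg /GRing.scale /=.
by field.
Qed.

Lemma grad_orient_notin (R : realType) n (P : 'M[R]_(2, n)) (t : triple n)
    (m : 'I_n) (a : 'I_2) : m \notin tset t -> grad_orient P t m a = 0.
Proof.
rewrite !inE !negb_or -andbA => /and3P[/negPf mi /negPf mj /negPf mk].
by rewrite /grad_orient mi mj mk /=; ring.
Qed.

Lemma sum_indicator (R : pzSemiRingType) (I : finType) (C : {set I})
    (c : I -> R) i :
  i \in C -> \sum_(m in C) c m * (m == i)%:R = c i.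
Proof.
move=> iC; rewrite (bigD1 i) //= eqxx mulr1 big1 ?addr0 // => m /andP[_ mi].
by rewrite (negPf mi) mulr0.
Qed.

(** The weights [c] let one formula serve both balances: constant 1 for forces, a coordinate of the
    points for moments. *)
Lemma sum_grad_orient (R : realType) n (P : 'M[R]_(2, n)) (t : triple n)
    (C : {set 'I_n}) (c : 'I_n -> R) (a : 'I_2) : tset t \subset C ->
  \sum_(m in C) c m * grad_orient P t m a =
    - (c (ti t) * edge_normal P (tj t) (tk t) a)
    + c (tj t) * edge_normal P (ti t) (tk t) a
    - c (tk t) * edge_normal P (ti t) (tj t) a.
Proof.
move=> /fintype.subsetP tC.
have [iC jC kC] : [/\ ti t \in C, tj t \in C & tk t \in C].
  by split; apply: tC; rewrite !inE eqxx ?orbT.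
rewrite -(sum_indicator c iC) -(sum_indicator c jC).
rewrite -(sum_indicator c kC) !mulr_suml -!sumrN -!big_split /=.
by apply: eq_bigr => m _; rewrite /grad_orient; ring.
Qed.

(** Translation invariance: the signed edge vectors around a triangle cancel. *)
Lemma sum_grad_area (R : realType) n (P : 'M[R]_(2, n)) (t : triple n)
    (C : {set 'I_n}) (a : 'I_2) : orient P t != 0 -> tset t \subset C ->
  \sum_(m in C) grad_area P t m a 0 = 0.
Proof.
move=> D0 tC; rewrite (eq_bigr (fun m => (2^-1 * Num.sg (orient P t)) *
    (1 * grad_orient P t m a))) => [|m _]; last by rewrite grad_areaE// mul1r.
rewrite -mulr_sumr (@sum_grad_orient _ _ _ _ _ (fun=> 1)) // /edge_normal.
by case: ifP => _; ring.
Qed.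

(* Euler's identity for the linear maps [I + h E_ab], whose determinant is
   [1 + h (b == a)]. *)
Lemma moment_grad_area (R : realType) n (P : 'M[R]_(2, n)) (t : triple n)
    (C : {set 'I_n}) (a b : 'I_2) : orient P t != 0 -> tset t \subset C ->
  \sum_(m in C) P b m * grad_area P t m a 0 = area P t *+ (b == a).
Proof.
move=> D0 tC; rewrite (eq_bigr (fun m => (2^-1 * Num.sg (orient P t)) *
    (P b m * grad_orient P t m a))) => [|m _]; last first.
  by rewrite grad_areaE //; ring.
rewrite -mulr_sumr sum_grad_orient // /area normrEsg.
rewrite [X in _ = _ * (_ * X) *+ _]orientE /edge_normal.
by case: (I2P a) => ->; case: (I2P b) => -> /=; rewrite ?mulr1n ?mulr0n; ring.
Qed.

(** * Components of the hypergraph of positive triples *)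

Lemma hyperadj_sym (R : realType) n (lam : 'rV[R]_#|triple n|) :
  connect_sym (hyperadj lam).
Proof.
apply: sym_connect_sym => i j; rewrite /hyperadj /=.
by apply: eq_existsb => t; rewrite [X in _ && X]andbC.
Qed.

(** Any two vertices of a positive triple are adjacent, so reaching one of them reaches all
    three. *)
Lemma component_edge (R : realType) n (lam : 'rV[R]_#|triple n|)
    (C : {set 'I_n}) (t : triple n) i :
  C \in components lam -> 0 < wt lam t -> i \in tset t -> i \in C ->
  tset t \subset C.
Proof.
move=> /imsetP[i0 _ ->] t0 it; rewrite inE => i0i.
apply/fintype.subsetP => j jt; rewrite inE; apply: connect_trans i0i _.
by apply: connect1; apply/existsP; exists t; rewrite t0 it jt.
Qed.

Lemma component_disjoint (R : realType) n (lam : 'rV[R]_#|triple n|)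
    (C C' : {set 'I_n}) i : C \in components lam -> C' \in components lam ->
  i \in C -> i \in C' -> C = C'.
Proof.
move=> /imsetP[i0 _ ->] /imsetP[i1 _ ->]; rewrite !inE => c0 c1.
apply/setP => j; rewrite !inE.
rewrite (same_connect (@hyperadj_sym _ _ lam) c0).
by rewrite (same_connect (@hyperadj_sym _ _ lam) c1).
Qed.

(** * Extracting positive reactions from balance identities *)

Lemma sum_exists_gt0 (R : realDomainType) (I : finType) (A : {pred I})
    (F : I -> R) :
  0 < \sum_(i in A) F i -> exists2 i, i \in A & 0 < F i.
Proof.
move=> S0; apply/exists_inP; apply: contraLR S0 => /exists_inPn F0.
by rewrite -leNgt; apply: sumr_le0 => i iA; rewrite leNgt F0.
Qed.

(* [lo] lives where [x = 0] and [hi] where [x = 1], so the moment of [hi - lo]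
   is the total of [hi]. *)
Lemma opposite_sides (R : realDomainType) (I : finType) (C : {set I})
    (x lo hi : I -> R) (s : R) :
  (forall i, x i <> 0 -> lo i = 0) -> (forall i, x i <> 1 -> hi i = 0) ->
  \sum_(i in C) (hi i - lo i) = 0 ->
  \sum_(i in C) x i * (hi i - lo i) = s -> 0 < s ->
  (exists2 i, i \in C & 0 < lo i) /\ (exists2 i, i \in C & 0 < hi i).
Proof.
move=> lo0 hi0 + + s0; rewrite sumrB => /eqP; rewrite subr_eq0 => /eqP E M.
suff H : \sum_(i in C) hi i = s.
  by split; apply: sum_exists_gt0; rewrite -?E H.
rewrite -M; apply: eq_bigr => i _.
have [x0|/eqP/lo0 ->] := eqVneq (x i) 0.
  by rewrite x0 mul0r hi0 // x0 => /esym/eqP; rewrite oner_eq0.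
have [->|/eqP/hi0 ->] := eqVneq (x i) 1; first by rewrite mul1r subr0.
by rewrite subr0 mulr0.
Qed.

(** * Force and moment balance over one component *)

Section Balance.
Context (R : realType) (n : nat) (P : 'M[R]_(2, n)).
Context (lam : 'rV[R]_#|triple n|) (l r d u : 'rV[R]_n).
Hypothesis n2 : (2 < n)%N.
Hypothesis deltaP : 0 < delta P.
Hypothesis K : KKT_multiplier P lam l r d u.

(** The least area is positive. This makes every area differentiable at [P] and rules out collinear
    triples. *)
Lemma orient_neq0 t : orient P t != 0.
Proof.
have := lt_le_trans deltaP ((delta_is_min P n2).2 t).
by rewrite /area pmulr_rgt0 ?invr_gt0 // normr_gt0.
Qed.

Lemma reaction_grad i a :
  reaction l r d u i a 0 = \sum_t wt lam t * grad_area P t i a 0.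
Proof.
have -> : \sum_t wt lam t * grad_area P t i a 0 =
          (\sum_t wt lam t *: grad_area P t i) a 0.
  by rewrite summxE; apply: eq_bigr => t _; rewrite [RHS]mxE.
have [_ _ _ _ /(_ i) /eqP] := K; rewrite addr_eq0 => /eqP ->.
by rewrite !mxE; case: ifP => _; rewrite opprB.
Qed.

(** Localization: after exchanging the sums, stationarity restricted to a component involves only
    the triples inside it. *)
Lemma sum_reaction_component (C : {set 'I_n}) (c : 'I_n -> R) a :
  C \in components lam ->
  \sum_(i in C) c i * reaction l r d u i a 0 =
  \sum_(t | tset t \subset C)
    wt lam t * \sum_(i in C) c i * grad_area P t i a 0.
Proof.
move=> Cc; under eq_bigr => i _ do rewrite reaction_grad mulr_sumr.
rewrite exchange_big /= [LHS](bigID (fun t => tset t \subset C)) /=.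
rewrite [X in _ + X]big1 ?addr0 => [|t tC].
  by apply: eq_bigr => t _; rewrite mulr_sumr; apply: eq_bigr => i _; ring.
(* A triple not inside [C] either has weight zero or misses [C] altogether, and then its gradient at
   each point of [C] vanishes. *)
rewrite big1 // => i iC; have [[/(_ t) wt0 _] _ _ _ _] := K.
move: wt0; rewrite le_eqVlt => /predU1P[<-|wt0]; first by rewrite mul0r mulr0.
rewrite grad_areaE ?orient_neq0 // grad_orient_notin ?mulr0 //.
by apply: contra tC => it; exact: component_edge Cc wt0 it iC.
Qed.

Lemma force_balance (C : {set 'I_n}) a : C \in components lam ->
  \sum_(i in C) reaction l r d u i a 0 = 0.
Proof.
move=> Cc; have := @sum_reaction_component C (fun=> 1) a Cc.
under eq_bigr do rewrite mul1r.
move=> ->; rewrite big1 // => t tC; under eq_bigr do rewrite mul1r.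
by rewrite sum_grad_area ?mulr0 ?orient_neq0.
Qed.

Lemma moment_balance (C : {set 'I_n}) a b : C \in components lam ->
  \sum_(i in C) P b i * reaction l r d u i a 0 =
  (comp_weight lam C * delta P) *+ (b == a).
Proof.
move=> Cc; rewrite sum_reaction_component // /comp_weight mulr_suml -sumrMnl.
apply: eq_bigr => t tC; rewrite moment_grad_area ?orient_neq0 //.
(* Complementary slackness: a triple whose area differs from [delta P] has weight zero, so each
   weighted area may be replaced by the weighted minimum. *)
have [_ /(_ t) slack _ _ _] := K.
have [<-|/eqP/slack ->] := eqVneq (area P t) (delta P).
  by rewrite mulrnAr.
by rewrite !mul0r mul0rn.
Qed.

(** * Reactions on the four sides *)

Lemma comp_weight_gt0 C : C \in pos_components lam -> 0 < comp_weight lam C.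
Proof.
rewrite inE => /andP[_ /existsP[t /andP[t0 tC]]].
have [[wt_ge0 _] _ _ _ _] := K.
by rewrite /comp_weight (bigD1 t) //= ltr_pwDl // sumr_ge0.
Qed.

(** In each coordinate, the force balance and the diagonal moment, which is positive, are the input
    of [opposite_sides]. *)
Lemma four_sides (C : {set 'I_n}) : C \in pos_components lam ->
  [/\ exists2 i, i \in C & 0 < l 0 i, exists2 i, i \in C & 0 < r 0 i,
      exists2 i, i \in C & 0 < d 0 i & exists2 i, i \in C & 0 < u 0 i].
Proof.
move=> Cp; have Cc : C \in components lam by move: Cp; rewrite inE => /andP[].
have [_ _ sides _ _] := K.
have s0 := mulr_gt0 (comp_weight_gt0 Cp) deltaP.
have F a := force_balance a Cc; have M a := moment_balance a a Cc.
have Ex i : reaction l r d u i ix 0 = r 0 i - l 0 i by rewrite mxE.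
have Ey i : reaction l r d u i iy 0 = u 0 i - d 0 i by rewrite mxE.
have [lC rC] : (exists2 i, i \in C & 0 < l 0 i) /\
    (exists2 i, i \in C & 0 < r 0 i).
  apply: (opposite_sides (x := P ix) _ _ _ _ s0) => [i|i||].
  - by have [] := sides i.
  - by have [] := sides i.
  - by rewrite -[RHS](F ix); apply: eq_bigr => i _; rewrite Ex.
  - by rewrite -[RHS]mulr1n -(M ix); apply: eq_bigr => i _; rewrite Ex.
have [dC uC] : (exists2 i, i \in C & 0 < d 0 i) /\
    (exists2 i, i \in C & 0 < u 0 i).
  apply: (opposite_sides (x := P iy) _ _ _ _ s0) => [i|i||].
  - by have [] := sides i.
  - by have [] := sides i.
  - by rewrite -[RHS](F iy); apply: eq_bigr => i _; rewrite Ey.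
  - by rewrite -[RHS]mulr1n -(M iy); apply: eq_bigr => i _; rewrite Ey.
by split.
Qed.

(** * Counting the positive components *)

Lemma no_three_on_left (i j k : 'I_n) : (i < j < k)%N ->
  P ix i = 0 -> P ix j = 0 -> P ix k = 0 -> False.
Proof.
move=> ijk i0 j0 k0; have := orient_neq0 (Sub (i, j, k) ijk : triple n).
by rewrite orientE /ti /tj /tk /= i0 j0 k0 !subrr !mul0r subrr eqxx.
Qed.

Lemma card_left_side (A : {set 'I_n}) :
  (forall i, i \in A -> P ix i = 0) -> (#|A| <= 2)%N.
Proof.
move=> A0; rewrite leqNgt; apply/negP => /card_gt2P[i [j [k [[iA jA kA]]]]].
have {iA jA kA} := (A0 _ iA, A0 _ jA, A0 _ kA) => -[[i0 j0] k0] [].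
(* Triples are indexed increasingly, so the three distinct indices are sorted first, one case per
   ordering. *)
case: (ltngtP i j) => [ij|ji|/val_inj->]; last by rewrite eqxx.
  case: (ltngtP j k) => [jk|kj|/val_inj->]; last by rewrite eqxx.
    by move=> _ _ _; apply: (@no_three_on_left i j k); rewrite ?ij.
  case: (ltngtP k i) => [ki|ik|/val_inj->]; last by rewrite eqxx.
    by move=> _ _ _; apply: (@no_three_on_left k i j); rewrite ?ki.
  by move=> _ _ _; apply: (@no_three_on_left i k j); rewrite ?ik.
case: (ltngtP i k) => [ik|ki|/val_inj->]; last by rewrite eqxx.
  by move=> _ _ _; apply: (@no_three_on_left j i k); rewrite ?ji.
case: (ltngtP j k) => [jk|kj|/val_inj->]; last by rewrite eqxx.
  by move=> _ _ _; apply: (@no_three_on_left j k i); rewrite ?jk.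
by move=> _ _ _; apply: (@no_three_on_left k j i); rewrite ?kj.
Qed.

(** Picking a point with positive left reaction in each positive component is injective, and by the
    side conditions all picks lie on the left side. *)
Lemma card_pos_components : (#|pos_components lam| <= 2)%N.
Proof.
have [->|[C0 C0p]] := set_0Vmem (pos_components lam); first by rewrite cards0.
have [[i0 _ _] _ _ _] := four_sides C0p.
(* The default [i0] only makes [f] total; on a positive component the pick succeeds. *)
pose f (C : {set 'I_n}) := odflt i0 [pick i in C | 0 < l 0 i].
have fP C : C \in pos_components lam -> f C \in C /\ 0 < l 0 (f C).
  move=> Cp; rewrite /f; case: pickP => [i /andP[]//|none].
  have [[i iC li] _ _ _] := four_sides Cp.
  by have := none i; rewrite iC li.
rewrite -(card_in_imset (f := f)) => [|C C' Cp C'p ff].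
  apply: card_left_side => _ /imsetP[C Cp ->]; have [_ lf] := fP _ Cp.
  have [_ _ /(_ (f C))[l0 _ _ _] _ _] := K.
  by have [//|/eqP/l0 lf0] := eqVneq (P ix (f C)) 0; rewrite lf0 ltxx in lf.
(* A common pick lies in both components, and distinct components are disjoint. *)
have [fC _] := fP _ Cp; have [fC' _] := fP _ C'p; rewrite -ff in fC'.
move: Cp C'p; rewrite !inE => /andP[Cc _] /andP[C'c _].
exact: component_disjoint Cc C'c fC fC'.
Qed.

End Balance.

Unset Implicit Arguments.

Theorem theorem4p3 (R : realType) (n : nat) (hn : (3 <= n)%N)
    (P : 'M[R]_(2, n)) (hP : pos_local_opt P)
    (lam : 'rV[R]_#|triple n|) (l r d u : 'rV[R]_n)
    (htheta : relint (KKT P) (lam, l, r, d, u)) :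
  (forall C : {set 'I_n}, C \in pos_components lam ->
    [/\ 0 < comp_weight lam C,
        \sum_(i in C) reaction l r d u i = 0,
        \sum_(i in C) col i P *m (reaction l r d u i)^T
          = (comp_weight lam C * delta P)%:M
      & [/\ exists2 i, i \in C & 0 < l 0 i,
            exists2 i, i \in C & 0 < r 0 i,
            exists2 i, i \in C & 0 < d 0 i
          & exists2 i, i \in C & 0 < u 0 i]])
  /\ (#|pos_components lam| <= 2)%N.
Proof.
have [_ _ delta_gt0] := hP; have K : KKT_multiplier P lam l r d u := htheta.1.
split; last exact: (card_pos_components hn delta_gt0 K).
move=> C Cp; have Cc : C \in components lam by move: Cp; rewrite inE => /andP[].
split.
- exact: (comp_weight_gt0 K Cp).
- apply/matrixP => a j; rewrite ord1 summxE mxE.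
  exact: (force_balance hn delta_gt0 K a Cc).
(* Entry [(b, a)] pairs coordinate [b] of the points with coordinate [a] of the reactions. *)
- apply/matrixP => b a; rewrite summxE mxE.
  rewrite -(moment_balance hn delta_gt0 K a b Cc); apply: eq_bigr => i _.
  by rewrite mxE big_ord1 !mxE.
- exact: (four_sides hn delta_gt0 K Cp).
Qed.
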